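(* Let $G$ be a connected graph of order $n$ and size $m$ with maximum degree $\Delta$ and minimum degree $\delta$. Then $$\left\lvert \frac{1}{m}BSO(G)-\frac{1}{m^2}SO(G)M_2^{*}(G)\right\rvert\leq \xi(m)\frac{\sqrt{2}(\Delta+\delta)(\Delta-\delta)^2}{\Delta^2\delta^2},$$ where $$\xi(m)=\frac{1}{4}\left(1-\frac{1+(-1)^{m+1}}{2m^2}\right).$$
   Context: Graphs are finite, simple and undirected; order and size are the numbers of vertices and edges. For a connected graph $G$ with edge set $E(G)$, $d_v$ denotes the degree of the vertex $v$ in $G$. The first Banhatti-Sombor index is $BSO(G)=\sum_{uv\in E(G)}\sqrt{\frac{1}{d_u^2}+\frac{1}{d_v^2}}$, the Sombor index is $SO(G)=\sum_{uv\in E(G)}\sqrt{d_u^2+d_v^2}$, and the modified second Zagreb index is $M_2^{*}(G)=\sum_{uv\in E(G)}\frac{1}{d_ud_v}$. *)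

(* Defs.v *)
From HB Require Import structures.
From mathcomp Require Import all_boot all_order all_algebra.

Set Implicit Arguments.
Unset Strict Implicit.
Unset Printing Implicit Defensive.

Import Order.TTheory GRing.Theory Num.Theory.

Local Open Scope ring_scope.

Record sgraph (T : finType) := SGraph {
  adj : rel T;
  adj_sym : symmetric adj;
  adj_irr : irreflexive adj
}.

Definition connected_graph (T : finType) (G : sgraph T) : Prop :=
  (0 < #|T|)%N /\ forall u v : T, connect (adj G) u v.

Definition edges (T : finType) (G : sgraph T) : {set {set T}} :=
  [set [set u; v] | u in T, v in [set v | adj G u v]].

Definition degree (T : finType) (G : sgraph T) (v : T) : nat :=
  #|[set w | adj G v w]|.

Definition max_degree (T : finType) (G : sgraph T) : nat :=
  (\max_(v : T) degree G v)%N.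

(* Every degree is smaller than #|T|, so the starting value #|T| is never the
   result when T is nonempty. *)
Definition min_degree (T : finType) (G : sgraph T) : nat :=
  \big[minn/#|T|]_(v : T) degree G v.

(* An edge is the two-element set e of its endpoints, so the symmetric
   expressions d_u^-2 + d_v^-2, d_u^2 + d_v^2 and d_u d_v attached to the edge uv
   are written as a sum or a product over the elements of e. *)
Definition BSO (R : rcfType) (T : finType) (G : sgraph T) : R :=
  \sum_(e in edges G) Num.sqrt (\sum_(v in e) 1 / (degree G v)%:R ^+ 2).

Definition SO (R : rcfType) (T : finType) (G : sgraph T) : R :=
  \sum_(e in edges G) Num.sqrt (\sum_(v in e) (degree G v)%:R ^+ 2).

Definition M2star (R : rcfType) (T : finType) (G : sgraph T) : R :=
  \sum_(e in edges G) 1 / \prod_(v in e) (degree G v)%:R.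

Definition xi (R : rcfType) (m : nat) : R :=
  1 / 4 * (1 - (1 + (-1) ^+ m.+1) / (2 * m%:R ^+ 2)).

(* Main.v *)
Require Import Defs.
From HB Require Import structures.
From mathcomp Require Import all_boot all_order all_algebra.
From mathcomp Require Import zify ring lra.

Set Implicit Arguments.
Unset Strict Implicit.
Unset Printing Implicit Defensive.

Import Order.TTheory GRing.Theory Num.Theory.

Local Open Scope ring_scope.

(** Over an edge uv put a = sqrt (d_u ^ 2 + d_v ^ 2) and b = 1 / (d_u d_v).
    Then a b = sqrt (1 / d_u ^ 2 + 1 / d_v ^ 2), so the quantity to bound is
    the covariance of a and b for the uniform measure on the edges.  Since
    a ranges over [sqrt 2 * delta, sqrt 2 * Delta] and b over
    [1 / Delta ^ 2, 1 / delta ^ 2], the theorem is the sharp discrete Grüss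
    inequality (Biernacki, Pidek and Ryll-Nardzewski), here [gruss], whose
    constant is [xi m] = floor (m ^ 2 / 4) / m ^ 2.

    The Grüss inequality rests on two extremal choices.  The difference
    m * sum a_i b_i - (sum a_i) (sum b_i) equals sum a_i c_i, where
    c_i = sum_j (b_i - b_j) has total 0.  It is linear in a, hence at most the
    width of the range of a times the sum of the positive c_i.  If S is the set
    of these i, then in sum_(i in S) c_i the terms with both indices in S
    cancel, and the remaining |S| (m - |S|) differences b_i - b_j are each at
    most the width of the range of b.  Finally |S| (m - |S|) is at most
    floor (m ^ 2 / 4).

    When there are no edges both sides vanish.  Otherwise connectedness rules
    out isolated vertices, so that delta > 0 and the range of b is bounded. *)

(** * The discrete Grüss inequality *)

Section Gruss.

Variables (R : realFieldType) (I : finType).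
Implicit Types (E S : {set I}) (a b : I -> R).

Lemma sum_sub_swap E b : \sum_(i in E) \sum_(j in E) (b i - b j) = 0.
Proof.
under eq_bigr do rewrite sumrB.
by rewrite sumrB [X in _ - X]exchange_big /= subrr.
Qed.

Lemma covariance_linear E a b :
  #|E|%:R * (\sum_(i in E) a i * b i)
    - (\sum_(i in E) a i) * (\sum_(i in E) b i)
  = \sum_(i in E) a i * \sum_(j in E) (b i - b j).
Proof.
rewrite mulr_suml mulr_sumr -sumrB; apply: eq_bigr => i _.
by rewrite sumrB sumr_const -mulr_natl; ring.
Qed.

(** Only the pairs leaving S contribute: the others cancel by antisymmetry. *)
Lemma sum_sub_le_cut E S b (b0 b1 : R) : S \subset E ->
  (forall i, i \in E -> b0 <= b i <= b1) ->
  \sum_(i in S) \sum_(j in E) (b i - b j)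
    <= (#|S| * (#|E| - #|S|))%:R * (b1 - b0).
Proof.
move=> sSE bE.
under eq_bigr do rewrite (big_setID S) /= (setIidPr sSE).
rewrite big_split /= sum_sub_swap add0r.
rewrite -cardsDS //.
have H i : i \in S -> \sum_(j in E :\: S) (b i - b j) <= #|E :\: S|%:R * (b1 - b0).
  move=> iS; rewrite mulr_natl -sumr_const; apply: ler_sum => j.
  rewrite inE => /andP[_ jE]; apply: lerB.
    by have /andP[] := bE i (subsetP sSE i iS).
  by have /andP[] := bE j jE.
apply: le_trans (ler_sum _ H) _.
by rewrite sumr_const natrM -mulrA [leRHS]mulr_natl.
Qed.

Lemma mul_complement_le (k m : nat) :
  (k <= m)%N -> (4 * (k * (m - k)) + odd m <= m ^ 2)%N.
Proof.
move=> /subnKC; set l := (m - k)%N => <-.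
(* The gap (k + l) ^ 2 - 4 k l is (k - l) ^ 2, which is odd when k + l is. *)
wlog: k l / (k <= l)%N => [hw|/subnKC <-].
  by case/orP: (leq_total k l) => /hw //; rewrite (addnC l) (mulnC l).
set d := (l - k)%N; rewrite addnA addnn oddD odd_double /=.
have : (odd d <= d ^ 2)%N by case: d => [|d] //; case: (odd _).
by move: (odd d : nat) => o; nia.
Qed.

Lemma covariance_le E a b (a0 a1 b0 b1 : R) :
  (forall i, i \in E -> a0 <= a i <= a1) ->
  (forall i, i \in E -> b0 <= b i <= b1) -> a0 <= a1 -> b0 <= b1 ->
  #|E|%:R * (\sum_(i in E) a i * b i)
    - (\sum_(i in E) a i) * (\sum_(i in E) b i)
  <= (#|E|%:R ^+ 2 - (odd #|E|)%:R) / 4 * ((a1 - a0) * (b1 - b0)).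
Proof.
move=> aE bE a01 b01; rewrite covariance_linear.
pose c i := \sum_(j in E) (b i - b j); pose S := [set i in E | 0 <= c i].
have sSE : S \subset E by apply/subsetP => i; rewrite inE => /andP[].
(* Since c sums to 0, a may be shifted to start at 0. *)
have -> : \sum_(i in E) a i * c i = \sum_(i in E) (a i - a0) * c i.
  under [RHS]eq_bigr do rewrite mulrBl.
  by rewrite sumrB -mulr_sumr sum_sub_swap mulr0 subr0.
have posS : \sum_(i in E) (a i - a0) * c i <= (a1 - a0) * \sum_(i in S) c i.
  rewrite (big_setID S) /= (setIidPr sSE) mulr_sumr -[leRHS]addr0.
  apply: lerD.
    apply: ler_sum => i; rewrite inE => /andP[/aE/andP[_ ai] ci].
    by rewrite ler_wpM2r // lerB.
  apply: sumr_le0 => i; rewrite !inE => /andP[+ iE]; rewrite iE /= -ltNge => ci.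
  have /andP[ai _] := aE i iE.
  by rewrite mulr_ge0_le0 ?subr_ge0 // ltW.
apply: le_trans posS _; rewrite mulrCA ler_wpM2l ?subr_ge0 //.
apply: le_trans (sum_sub_le_cut sSE bE) _.
rewrite ler_wpM2r ?subr_ge0 //.
have := mul_complement_le (subset_leq_card sSE).
rewrite -(ler_nat R) natrD natrX (natrM _ 4); lra.
Qed.

End Gruss.

Lemma xi_odd (R : rcfType) (m : nat) :
  xi R m = 1 / 4 * (1 - (odd m)%:R / m%:R ^+ 2).
Proof.
rewrite /xi -signr_odd /= invfM mulrA; congr (_ * (1 - _ * _)).
by case: (odd m) => /=; rewrite ?expr0 ?expr1; lra.
Qed.

(** The lower bound is the upper bound for a and - b. *)
Lemma gruss (R : rcfType) (I : finType) (E : {set I}) (a b : I -> R)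
    (a0 a1 b0 b1 : R) : (0 < #|E|)%N ->
  (forall i, i \in E -> a0 <= a i <= a1) ->
  (forall i, i \in E -> b0 <= b i <= b1) ->
  `| 1 / #|E|%:R * (\sum_(i in E) a i * b i)
     - 1 / #|E|%:R ^+ 2 * ((\sum_(i in E) a i) * (\sum_(i in E) b i)) |
  <= xi R #|E| * ((a1 - a0) * (b1 - b0)).
Proof.
move=> E0 aE bE; have [i iE] := card_gt0P E0.
have a01 : a0 <= a1 by have /andP[/le_trans] := aE i iE; apply.
have b01 : b0 <= b1 by have /andP[/le_trans] := bE i iE; apply.
have m0 : 0 < #|E|%:R :> R by rewrite ltr0n.
have bNE j : j \in E -> - b1 <= - b j <= - b0.
  by move=> /bE; rewrite !lerN2 andbC.
have up := covariance_le aE bE a01 b01.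
have bN01 : - b1 <= - b0 by rewrite lerN2.
have := covariance_le aE bNE a01 bN01.
under eq_bigr do rewrite mulrN.
rewrite !sumrN => lo.
rewrite xi_odd; move: up lo m0.
move: (\sum_(i in E) a i * b i) (\sum_(i in E) a i) (\sum_(i in E) b i).
move: (_%:R : R) ((odd _)%:R : R) => m o s t u up lo m0.
have -> : 1 / m * s - 1 / m ^+ 2 * (t * u) = (m * s - t * u) / m ^+ 2.
  by field; rewrite gt_eqF.
have -> : 1 / 4 * (1 - o / m ^+ 2) * ((a1 - a0) * (b1 - b0))
   = (m ^+ 2 - o) / 4 * ((a1 - a0) * (b1 - b0)) / m ^+ 2.
  by field; rewrite gt_eqF.
rewrite normf_div normrX (gtr0_norm m0) ler_pM2r ?invr_gt0 ?exprn_gt0 //.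
rewrite ler_norml; apply/andP; split; lra.
Qed.

(** * Degrees *)

Section Degrees.

Variables (T : finType) (G : sgraph T).

Lemma edgeP e : e \in edges G ->
  exists u v : T, [/\ u != v, adj G u v & e = [set u; v]].
Proof.
case/imset2P => u v _; rewrite inE => uv ->; exists u, v; split => //.
by apply: contraTneq uv => ->; rewrite adj_irr.
Qed.

Lemma min_degree_le v : (min_degree G <= degree G v)%N.
Proof.
rewrite /min_degree; have := mem_index_enum v.
elim: (index_enum T) => // w r IHr; rewrite inE big_cons geq_min.
by case/predU1P => [<- | /IHr ->]; rewrite ?leqnn ?orbT.
Qed.

Lemma le_max_degree v : (degree G v <= max_degree G)%N.
Proof. exact: leq_bigmax. Qed.

(** A path from w to another vertex starts with an edge at w. *)
Lemma min_degree_gt0 (u v : T) :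
  connected_graph G -> u != v -> (0 < min_degree G)%N.
Proof.
move=> [T0 conn] uv; rewrite /min_degree; elim/big_ind: _ => //.
  by move=> x y x0 y0; rewrite leq_min x0.
move=> w _.
have [x wx] : exists x, w != x.
  by case: (eqVneq w u) => [->|wu]; [exists v | exists u].
have /connectP[[|y p] /=] := conn w x; first by move=> _ /eqP; rewrite eq_sym (negbTE wx).
by case/andP => wy _ _; apply/card_gt0P; exists y; rewrite inE.
Qed.

Lemma no_edge_degree v : #|edges G| = 0%N -> degree G v = 0%N.
Proof.
move=> /eqP; rewrite cards_eq0 => /eqP E0; apply/eqP; rewrite cards_eq0.
apply/eqP/setP => w; rewrite !inE; apply/negbTE/negP => vw.
suff : [set v; w] \in edges G by rewrite E0 inE.
by apply/imset2P; exists v w; rewrite ?inE.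
Qed.

End Degrees.

(** * Ranges of the two edge weights *)

Lemma sqrt_inv_sqr_sum (R : rcfType) (x y : R) : 0 < x -> 0 < y ->
  Num.sqrt (1 / x ^+ 2 + 1 / y ^+ 2) = Num.sqrt (x ^+ 2 + y ^+ 2) * (1 / (x * y)).
Proof.
move=> x0 y0.
have xy0 : 0 <= 1 / (x * y) by rewrite divr_ge0 ?ler01 // mulr_ge0 // ltW.
rewrite -[1 / (x * y)](ger0_norm xy0) -sqrtr_sqr -sqrtrM; last first.
  by rewrite addr_ge0 ?sqr_ge0.
by congr Num.sqrt; field; rewrite !gt_eqF.
Qed.

Lemma sqrt_sqr_sum_bounds (R : rcfType) (p q x y : R) :
  0 <= p -> p <= x <= q -> p <= y <= q ->
  Num.sqrt 2 * p <= Num.sqrt (x ^+ 2 + y ^+ 2) <= Num.sqrt 2 * q.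
Proof.
move=> p0 /andP[px xq] /andP[py yq].
have sq z : 0 <= z -> Num.sqrt 2 * z = Num.sqrt (2 * z ^+ 2) :> R.
  by move=> z0; rewrite sqrtrM // sqrtr_sqr ger0_norm.
have q0 : 0 <= q by lra.
by rewrite !sq //; apply/andP; split; apply: ler_wsqrtr; nra.
Qed.

Lemma inv_prod_bounds (R : realFieldType) (p q x y : R) :
  0 < p -> p <= x <= q -> p <= y <= q ->
  1 / q ^+ 2 <= 1 / (x * y) <= 1 / p ^+ 2.
Proof.
move=> p0 /andP[px xq] /andP[py yq].
by rewrite !div1r !lef_pV2 ?posrE; [apply/andP; split | ..]; nra.
Qed.

Theorem theorem3p21 (R : rcfType) (T : finType) (G : sgraph T)
    (n m Delta delta : nat)
    (G_connected : connected_graph G)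
    (G_order : #|T| = n) (G_size : #|edges G| = m)
    (G_max : max_degree G = Delta) (G_min : min_degree G = delta) :
  `| 1 / m%:R * BSO R G - 1 / m%:R ^+ 2 * (SO R G * M2star R G) |
    <= xi R m *
       (Num.sqrt 2 * (Delta%:R + delta%:R) * (Delta%:R - delta%:R) ^+ 2
         / (Delta%:R ^+ 2 * delta%:R ^+ 2)).
Proof.
have [m0|m0] := posnP m.
  have D0 : Delta = 0%N.
    rewrite -G_max; apply/eqP; rewrite -leqn0; apply/bigmax_leqP => v _.
    by rewrite no_edge_degree ?G_size.
  by rewrite m0 D0 !expr2 !invr0 !(mulr0, mul0r, subr0, invr0) normr0.
have [e0 /edgeP[u0 [v0 [uv0 _ _]]]] : exists e, e \in edges G.
  by apply/card_gt0P; rewrite G_size.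
have d0 : 0 < delta%:R :> R by rewrite ltr0n -G_min (min_degree_gt0 _ uv0).
have range (v : T) : (delta%:R <= (degree G v)%:R :> R) && ((degree G v)%:R <= Delta%:R :> R).
  by rewrite !ler_nat -G_min -G_max min_degree_le le_max_degree.
have pos v : 0 < (degree G v)%:R :> R.
  by have /andP[h _] := range v; apply: lt_le_trans h.
have D0 : 0 < Delta%:R :> R.
  by have /andP[_ h] := range u0; apply: lt_le_trans h.
pose a (e : {set T}) : R := Num.sqrt (\sum_(v in e) (degree G v)%:R ^+ 2).
pose b (e : {set T}) : R := 1 / \prod_(v in e) (degree G v)%:R.
have -> : BSO R G = \sum_(e in edges G) a e * b e.
  apply: eq_bigr => e /edgeP[u [v [uv _ ->]]].
  rewrite /a /b !big_setU1 ?inE //= !big_set1.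
  by rewrite sqrt_inv_sqr_sum.
have -> : Num.sqrt 2 * (Delta%:R + delta%:R) * (Delta%:R - delta%:R) ^+ 2
         / (Delta%:R ^+ 2 * delta%:R ^+ 2)
  = (Num.sqrt 2 * Delta%:R - Num.sqrt 2 * delta%:R)
    * (1 / delta%:R ^+ 2 - 1 / Delta%:R ^+ 2) :> R.
  by field; rewrite !gt_eqF.
rewrite -G_size; apply: gruss; first by rewrite G_size.
  move=> e /edgeP[u [v [uv _ ->]]]; rewrite /a !big_setU1 ?inE //= !big_set1.
  by apply: sqrt_sqr_sum_bounds => //; apply: ltW.
move=> e /edgeP[u [v [uv _ ->]]]; rewrite /b !big_setU1 ?inE //= !big_set1.
exact: inv_prod_bounds.
Qed.
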